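(* Let $\Lambda$ be a $k$-graph. The path groupoid $\mathcal{G}_\Lambda$ is essentially free (i.e. the points with trivial isotropy are dense in the unit space $\mathcal{G}_\Lambda^0$) if and only if $\Lambda$ satisfies the aperiodicity condition: for every $v\in\Lambda^0$ there is an aperiodic path $x\in\Lambda^\infty(v)$.
   Context: Let $\mathbf{N}=\{0,1,2,\dots\}$, $k\ge 1$, and order $\mathbf{N}^k$ (and $\mathbf{Z}^k$) coordinatewise. A $k$-graph $(\Lambda,d)$ is a countable small category $\Lambda$ (range map $r$, source map $s$) with a functor $d:\Lambda\to\mathbf{N}^k$ satisfying the factorisation property: if $d(\lambda)=m+n$ there are unique $\mu,\nu\in\Lambda$ with $\lambda=\mu\nu$, $d(\mu)=m$, $d(\nu)=n$. $\lambda\mu$ is defined iff $s(\lambda)=r(\mu)$. Put $\Lambda^n=d^{-1}(n)$; $\Lambda^0$ is identified with the set of objects; $\Lambda^n(v)=\{\lambda\in\Lambda^n: r(\lambda)=v\}$. Standing assumption: $0<\#\Lambda^n(v)<\infty$ for all $v\in\Lambda^0$, $n\in\mathbf{N}^k$. $\Omega_k=\{(m,n)\in\mathbf{N}^k\times\mathbf{N}^k: m\le n\}$ is the $k$-graph with objects $\mathbf{N}^k$, $r(m,n)=m$, $s(m,n)=n$, $d(m,n)=n-m$. $\Lambda^\infty$ is the set of degree-preserving functors $x:\Omega_k\to\Lambda$; $x(m)$ denotes $x(m,m)$; $\Lambda^\infty(v)=\{x: x(0)=v\}$; $\sigma^p(x)(m,n)=x(m+p,n+p)$. If $x(0)=s(\lambda)$,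 then $\lambda x$ is the unique $y\in\Lambda^\infty$ with $\sigma^{d(\lambda)}y=x$ and $y(0,d(\lambda))=\lambda$. $p\in\mathbf{Z}^k$ is a period of $x\in\Lambda^\infty$ if $x(m+p,n+p)=x(m,n)$ for every $(m,n)\in\Omega_k$ with $m+p\ge 0$. $x$ is periodic if it has a nonzero period, eventually periodic if $\sigma^n x$ is periodic for some $n\in\mathbf{N}^k$, and aperiodic otherwise (i.e. if not eventually periodic). $\mathcal{G}_\Lambda=\{(x,n,y)\in\Lambda^\infty\times\mathbf{Z}^k\times\Lambda^\infty:\sigma^\ell x=\sigma^m y,\ n=\ell-m\text{ for some }\ell,m\in\mathbf{N}^k\}$ with $r(x,n,y)=x$, $s(x,n,y)=y$, $(x,n,y)(y,\ell,z)=(x,n+\ell,z)$, $(x,n,y)^{-1}=(y,-n,x)$; topology with basis $Z(\lambda,\mu)=\{(\lambda z,d(\lambda)-d(\mu),\mu z): z\in\Lambda^\infty(s(\lambda))\}$, $s(\lambda)=s(\mu)$. Its unit space $\mathcal{G}_\Lambda^0$ is identified with $\Lambda^\infty$ via $x\mapsto(x,0,x)$, whose topology has basis $Z(\lambda)=\{x: x(0,d(\lambda))=\lambda\}$. The isotropy of $x$ is the group $\{(x,n,x)\in\mathcal{G}_\Lambda\}$. *)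

(* Defs.v *)
From HB Require Import structures.
From mathcomp Require Import all_boot all_order all_algebra.
From mathcomp Require Import all_classical topology.
From mathcomp Require Import zify.

Set Implicit Arguments.
Unset Strict Implicit.
Unset Printing Implicit Defensive.

Import Order.TTheory GRing.Theory Num.Theory.
Local Open Scope classical_set_scope.
Local Open Scope ring_scope.

Notation Nk k := {ffun 'I_k -> nat}.
Notation Zk k := {ffun 'I_k -> int}.

Definition NtoZ k (m : Nk k) : Zk k := [ffun i => (m i)%:Z].
Definition leNk k (m n : Nk k) : bool := [forall i, (m i <= n i)%N].
(* truncated, so meaningful only when [leNk m n] *)
Definition subNk k (n m : Nk k) : Nk k := [ffun i => (n i - m i)%N].

(* [ccomp f g] is the composite f g (f after g) when [csource f = crange g];
   it is unconstrained otherwise. *)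
Record category (O M : Type) := Category {
  crange : M -> O;
  csource : M -> O;
  cident : O -> M;
  ccomp : M -> M -> M;
  crange_id : forall v, crange (cident v) = v;
  csource_id : forall v, csource (cident v) = v;
  crange_comp : forall f g, csource f = crange g -> crange (ccomp f g) = crange f;
  csource_comp : forall f g, csource f = crange g -> csource (ccomp f g) = csource g;
  ccompA : forall f g h, csource f = crange g -> csource g = crange h ->
    ccomp (ccomp f g) h = ccomp f (ccomp g h);
  ccomp_idl : forall f, ccomp (cident (crange f)) f = f;
  ccomp_idr : forall f, ccomp f (cident (csource f)) = f
}.

(* Objects are kept apart from the degree-0 morphisms; [cident] identifies them. *)
Record kgraph (k : nat) := KGraph {
  kobj : Type;
  kmor : Type;
  kcat :> category kobj kmor;
  kmor_countable : countable [set: kmor];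
  kdeg : kmor -> Nk k;
  kdeg_id : forall v, kdeg (cident kcat v) = 0;
  kdeg_comp : forall f g, csource kcat f = crange kcat g ->
    kdeg (ccomp kcat f g) = kdeg f + kdeg g;
  kfact : forall (f : kmor) (m n : Nk k), kdeg f = m + n ->
    exists! p : kmor * kmor,
      [/\ csource kcat p.1 = crange kcat p.2, f = ccomp kcat p.1 p.2,
          kdeg p.1 = m & kdeg p.2 = n]
}.
Arguments kdeg {k L} _ : rename.

(* [kpaths L n v] is the set written Lambda^n(v). *)
Definition kpaths k (L : kgraph k) (n : Nk k) (v : kobj L) : set (kmor L) :=
  [set f | kdeg f = n /\ crange L f = v].

Record kmorphism k (A B : kgraph k) := KMorphism {
  fobj : kobj A -> kobj B;
  fmor : kmor A -> kmor B;
  fmor_range : forall f, crange B (fmor f) = fobj (crange A f);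
  fmor_source : forall f, csource B (fmor f) = fobj (csource A f);
  fmor_id : forall v, fmor (cident A v) = cident B (fobj v);
  fmor_comp : forall f g, csource A f = crange A g ->
    fmor (ccomp A f g) = ccomp B (fmor f) (fmor g);
  fmor_deg : forall f, kdeg (fmor f) = kdeg f
}.

Section Nk.
Context (k : nat).
Implicit Types m n p : Nk k.

Lemma leNkP m n : reflect (forall i, (m i <= n i)%N) (leNk m n).
Proof. exact: forallP. Qed.

Lemma leNk_refl m : leNk m m.
Proof. by apply/leNkP. Qed.

Lemma leNk_trans m n p : leNk m n -> leNk n p -> leNk m p.
Proof.
by move=> /leNkP mn /leNkP np; apply/leNkP => i; exact: leq_trans (mn i) (np i).
Qed.

Lemma leNk0 n : leNk 0 n.
Proof. by apply/leNkP => i; rewrite ffunE. Qed.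

Lemma addNkE m n i : (m + n) i = (m i + n i)%N.
Proof. by rewrite ffunE. Qed.

Lemma leNk_addl m n : leNk n (m + n).
Proof. by apply/leNkP => i; rewrite addNkE leq_addl. Qed.

Lemma leNk_addr m n : leNk m (m + n).
Proof. by apply/leNkP => i; rewrite addNkE leq_addr. Qed.

Lemma leNk_add2r p m n : leNk m n -> leNk (m + p) (n + p).
Proof. by move=> /leNkP mn; apply/leNkP => i; rewrite !addNkE leq_add2r. Qed.

Lemma subNkK m n : leNk m n -> m + subNk n m = n.
Proof.
by move=> /leNkP mn; apply/ffunP => i; rewrite addNkE ffunE subnKC.
Qed.

End Nk.

Section Omega.
Context (k : nat).

Local Notation omega_mor := {mn : Nk k * Nk k | leNk mn.1 mn.2}.

Definition omor (m n : Nk k) (mn : leNk m n) : omega_mor := exist _ (m, n) mn.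

Definition omega_comp (f g : omega_mor) : omega_mor :=
  insubd f ((val f).1, (val g).2).

Lemma omega_compE f g : (val f).2 = (val g).1 ->
  val (omega_comp f g) = ((val f).1, (val g).2).
Proof.
move=> fg; rewrite val_insubd /= ifT//.
by apply: leNk_trans (valP f) _; rewrite fg; exact: (valP g).
Qed.

Program Definition omega_cat : category (Nk k) omega_mor :=
  @Category _ _ (fun f => (val f).1) (fun f => (val f).2)
    (fun m => omor (leNk_refl m)) omega_comp _ _ _ _ _ _ _.
Next Obligation. by move=> v. Qed.
Next Obligation. by move=> v. Qed.
Next Obligation. by move=> f g /= fg; rewrite omega_compE. Qed.
Next Obligation. by move=> f g /= fg; rewrite omega_compE. Qed.
Next Obligation.
by move=> f g h /= fg gh; apply: val_inj; rewrite !omega_compE //= omega_compE.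
Qed.
Next Obligation.
by move=> f /=; apply: val_inj; rewrite omega_compE //=; case: (val f).
Qed.
Next Obligation.
by move=> f /=; apply: val_inj; rewrite omega_compE //=; case: (val f).
Qed.

Program Definition Omega : kgraph k :=
  @KGraph k _ _ omega_cat _ (fun f => subNk (val f).2 (val f).1) _ _ _.
Next Obligation. exact: countableP. Qed.
Next Obligation. by move=> v; apply/ffunP => i; rewrite !ffunE subnn. Qed.
Next Obligation.
move=> f g /= fg; rewrite omega_compE //=; apply/ffunP => i.
rewrite addNkE !ffunE -fg.
have /leNkP/(_ i) := valP f; have /leNkP/(_ i) := valP g.
by rewrite -fg => ? ?; rewrite addnC addnBA// subnK.
Qed.
Next Obligation.
move=> [[a b] /= ab] m n /ffunP fmn.
have bE : b = a + m + n.
  apply/ffunP => i; have := fmn i; rewrite !addNkE ffunE /= -addnA => <-.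
  by rewrite subnKC//; exact: (leNkP _ _ ab).
exists (omor (leNk_addr a m), omor (leNk_addr (a + m) n)); split.
  split => //=.
  - by apply: val_inj; rewrite omega_compE //= bE.
  - by apply/ffunP => i; rewrite ffunE !addNkE addKn.
  - by apply/ffunP => i; rewrite ffunE !addNkE addKn.
move=> [f g] /= [fg E fm gn].
have [af bg] : a = (sval f).1 /\ b = (sval g).2.
  by have := congr1 val E; rewrite omega_compE //= => -[].
have cf : (sval f).2 = a + m by rewrite -fm af subNkK//; exact: valP f.
congr (_, _); apply: val_inj => /=.
- by rewrite -cf af; case: (sval f).
- by rewrite -bE -cf bg fg; case: (sval g).
Qed.

End Omega.

Section InfinitePaths.
Context (k : nat) (L : kgraph k).

Definition ipath : Type := kmorphism (Omega k) L.
HB.instance Definition _ := gen_eqMixin ipath.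
HB.instance Definition _ := gen_choiceMixin ipath.

Implicit Types x y z : ipath.

(* [vertex x m] is x(m) and [seg x mn] is x(m, n). *)
Definition vertex x (m : Nk k) : kobj L := fobj x m.
Definition seg x (m n : Nk k) (mn : leNk m n) : kmor L := fmor x (omor mn).

Definition omega_shift (p : Nk k) (f : kmor (Omega k)) : kmor (Omega k) :=
  omor (leNk_add2r p (valP f)).

Program Definition shift (p : Nk k) x : ipath :=
  @KMorphism k (Omega k) L (fun m => fobj x (m + p))
    (fun f => fmor x (omega_shift p f)) _ _ _ _ _.
Next Obligation. by move=> p x f; rewrite fmor_range. Qed.
Next Obligation. by move=> p x f; rewrite fmor_source. Qed.
Next Obligation.
by move=> p x v; rewrite -fmor_id; congr fmor; apply: val_inj.
Qed.
Next Obligation.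
move=> p x f g /= fg; rewrite -fmor_comp /= ?fg//; congr fmor; apply: val_inj.
by rewrite omega_compE /= ?fg// omega_compE.
Qed.
Next Obligation.
by move=> p x f; rewrite fmor_deg /=; apply/ffunP => i; rewrite !ffunE; exact: subnDr.
Qed.

(* [m'] and [n'] are m + p and n + p, so [m'] exists in N^k iff m + p >= 0. *)
Definition is_period x (p : Zk k) : Prop :=
  forall (m n m' n' : Nk k) (mn : leNk m n) (mn' : leNk m' n'),
    NtoZ m' = NtoZ m + p -> NtoZ n' = NtoZ n + p -> seg x mn' = seg x mn.

Definition periodic x : Prop := exists2 p : Zk k, p != 0 & is_period x p.
Definition eventually_periodic x : Prop := exists n : Nk k, periodic (shift n x).
Definition aperiodic x : Prop := ~ eventually_periodic x.

Definition aperiodicity_condition : Prop :=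
  forall v : kobj L, exists2 x : ipath, vertex x 0 = v & aperiodic x.

(* y is the path f x: for x(0) = s(f), the factorisation property gives exactly
   one such y. *)
Definition is_concat (f : kmor L) x y : Prop :=
  shift (kdeg f) y = x /\ seg y (leNk0 (kdeg f)) = f.

End InfinitePaths.

Arguments vertex {k L} _ _.
Arguments seg {k L} _ {m n} _.
Arguments shift {k L} _ _.

Record groupoid (O M : Type) := Groupoid {
  gcat :> category O M;
  ginv : M -> M;
  grange_inv : forall g, crange gcat (ginv g) = csource gcat g;
  gsource_inv : forall g, csource gcat (ginv g) = crange gcat g;
  gcompV : forall g, ccomp gcat g (ginv g) = cident gcat (crange gcat g);
  gcompVg : forall g, ccomp gcat (ginv g) g = cident gcat (csource gcat g)
}.

Definition isotropy O M (G : groupoid O M) (u : O) : set M :=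
  [set g | crange G g = u /\ csource G g = u].

(* The unit space carries the topology induced by the arrow space via
   u |-> [cident G u]. *)
Definition essentially_free (O : choiceType) (M : topologicalType)
    (G : groupoid O M) : Prop :=
  dense ([set u | isotropy G u = [set cident G u]]
         : set (initial_topology (cident G))).

Section PathGroupoid.
Context (k : nat) (L : kgraph k).

Record parrow := PArrow {
  prange : ipath L;
  pcocycle : Zk k;
  psource : ipath L;
  parrowP : exists l m : Nk k,
    shift l prange = shift m psource /\ pcocycle = NtoZ l - NtoZ m
}.
HB.instance Definition _ := gen_eqMixin parrow.
HB.instance Definition _ := gen_choiceMixin parrow.

Lemma parrow_eq (g h : parrow) : prange g = prange h ->
  pcocycle g = pcocycle h -> psource g = psource h -> g = h.
Proof.
case: g h => [x n y P] [x' n' y' P'] /= ? ? ?; subst.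
by congr PArrow; exact: Prop_irrelevance.
Qed.

Lemma NtoZD (m n : Nk k) : NtoZ (m + n) = NtoZ m + NtoZ n.
Proof. by apply/ffunP => i; rewrite !ffunE. Qed.

Lemma ipath_eq (x y : ipath L) :
  (forall m n (mn : leNk m n), seg x mn = seg y mn) -> x = y.
Proof.
move=> xy.
have fE : fmor x = fmor y.
  by apply/funext => -[[m n] /= mn]; exact: xy.
have oE : fobj x = fobj y.
  apply/funext => m.
  by rewrite -[LHS](crange_id L) -[RHS](crange_id L) -!fmor_id fE.
case: x y fE oE {xy} => [? ? ? ? ? ? ?] [? ? ? ? ? ? ?] /= ? ?; subst.
by congr KMorphism; exact: Prop_irrelevance.
Qed.

Lemma seg_congr (x : ipath L) m n m' n' (mn : leNk m n) (mn' : leNk m' n') :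
  m = m' -> n = n' -> seg x mn = seg x mn'.
Proof. by move=> ? ?; subst; congr seg; exact: bool_irrelevance. Qed.

Lemma seg_shift p (x : ipath L) m n (mn : leNk m n) :
  seg (shift p x) mn = seg x (leNk_add2r p mn).
Proof. by rewrite /seg /=; congr fmor; apply: val_inj. Qed.

Lemma shiftD p q (x : ipath L) : shift p (shift q x) = shift (p + q) x.
Proof.
apply: ipath_eq => m n mn; rewrite !seg_shift.
by apply: seg_congr; rewrite addrA.
Qed.

Lemma shift0 (x : ipath L) : shift 0 x = x.
Proof.
by apply: ipath_eq => m n mn; rewrite seg_shift; apply: seg_congr; rewrite addr0.
Qed.

Lemma seg_deg (x : ipath L) m n (mn : leNk m n) : kdeg (seg x mn) = subNk n m.
Proof. by rewrite /seg fmor_deg. Qed.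

Lemma seg_comp (x : ipath L) m n p (mn : leNk m n) (np : leNk n p)
    (mp : leNk m p) :
  seg x mp = ccomp L (seg x mn) (seg x np).
Proof.
rewrite /seg -fmor_comp//; congr fmor; apply: val_inj => /=.
by rewrite omega_compE.
Qed.

Lemma seg_composable (x : ipath L) m n p (mn : leNk m n) (np : leNk n p) :
  csource L (seg x mn) = crange L (seg x np).
Proof. by rewrite /seg fmor_source fmor_range. Qed.

Lemma kfact_inj (f g f' g' : kmor L) :
  csource L f = crange L g -> csource L f' = crange L g' ->
  ccomp L f g = ccomp L f' g' -> kdeg f = kdeg f' -> kdeg g = kdeg g' ->
  f = f' /\ g = g'.
Proof.
move=> fg fg' E df dg.
have [p [_ pU]] := kfact (kdeg_comp fg).
have e1 : p = (f, g) by apply: pU.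
have e2 : p = (f', g') by apply: pU; split.
by move: e1; rewrite e2 => -[-> ->].
Qed.

Lemma seg_split (x y : ipath L) m n p m' n' p' (mn : leNk m n) (np : leNk n p)
    (mp : leNk m p) (mn' : leNk m' n') (np' : leNk n' p') (mp' : leNk m' p') :
  subNk n m = subNk n' m' -> subNk p n = subNk p' n' ->
  seg x mp = seg y mp' -> seg x mn = seg y mn' /\ seg x np = seg y np'.
Proof.
move=> d1 d2 E; apply: kfact_inj.
- exact: seg_composable.
- exact: seg_composable.
- by rewrite -!seg_comp.
- by rewrite !seg_deg.
- by rewrite !seg_deg.
Qed.

Lemma concat_inj p (x y : ipath L) : shift p x = shift p y ->
  seg x (leNk0 p) = seg y (leNk0 p) -> x = y.
Proof.
move=> sxy xy0; apply: ipath_eq => m n mn.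
have pn : leNk p (n + p) := leNk_addl n p.
have E : seg x (leNk0 (n + p)) = seg y (leNk0 (n + p)).
  rewrite (seg_comp x (leNk0 p) pn) (seg_comp y (leNk0 p) pn) xy0; congr ccomp.
  have := congr1 (fun z => seg z (leNk0 n)) sxy.
  rewrite !seg_shift => E.
  by rewrite (seg_congr x pn (leNk_add2r p (leNk0 n))) ?add0r// E;
     apply: seg_congr; rewrite ?add0r.
have [E1 _] := seg_split (leNk0 n) (leNk_addr n p)
  (leNk0 n) (leNk_addr n p) erefl erefl E.
by have [] := seg_split (leNk0 m) mn (leNk0 m) mn erefl erefl E1.
Qed.

Lemma parrow_id_subproof (x : ipath L) : exists l m : Nk k,
  shift l x = shift m x /\ (0 : Zk k) = NtoZ l - NtoZ m.
Proof. by exists 0, 0; rewrite subrr. Qed.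

Definition parrow_id (x : ipath L) : parrow := PArrow (parrow_id_subproof x).

Lemma parrow_comp_subproof (g h : parrow) : psource g = prange h ->
  exists l m : Nk k, shift l (prange g) = shift m (psource h) /\
    pcocycle g + pcocycle h = NtoZ l - NtoZ m.
Proof.
case: g h => [x n y [a [b [xy nE]]]] [w n' z [c [d [yz nE']]]] /= yw; subst w.
exists (c + a), (b + d); split.
  by rewrite -(shiftD c a) xy shiftD (addrC c b) -(shiftD b c) yz shiftD.
by rewrite nE nE' !NtoZD opprD addrACA (addrC (NtoZ a)).
Qed.

Definition parrow_comp (g h : parrow) : parrow :=
  if pselect (psource g = prange h) is left gh
  then PArrow (parrow_comp_subproof gh) else g.

Lemma parrow_inv_subproof (g : parrow) : exists l m : Nk k,
  shift l (psource g) = shift m (prange g) /\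
    - pcocycle g = NtoZ l - NtoZ m.
Proof.
by case: g => [x n y [l [m [xy nE]]]] /=; exists m, l; rewrite nE opprB.
Qed.

Definition parrow_inv (g : parrow) : parrow := PArrow (parrow_inv_subproof g).

Lemma parrow_compE (g h : parrow) : psource g = prange h ->
  [/\ prange (parrow_comp g h) = prange g,
      pcocycle (parrow_comp g h) = pcocycle g + pcocycle h &
      psource (parrow_comp g h) = psource h].
Proof. by rewrite /parrow_comp; case: pselect. Qed.

Program Definition path_category : category (ipath L) parrow :=
  @Category _ _ prange psource parrow_id parrow_comp _ _ _ _ _ _ _.
Next Obligation. by []. Qed.
Next Obligation. by []. Qed.
Next Obligation. by move=> f g /= /parrow_compE[]. Qed.
Next Obligation. by move=> f g /= /parrow_compE[]. Qed.
Next Obligation.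
move=> f g h /= fg gh.
have [r1 n1 s1] := parrow_compE fg; have [r2 n2 s2] := parrow_compE gh.
have [r3 n3 s3] := parrow_compE (etrans s1 gh).
have [r4 n4 s4] := parrow_compE (etrans fg (esym r2)).
by apply: parrow_eq; rewrite ?r3 ?r4 ?n3 ?n4 ?s3 ?s4 ?n1 ?n2 ?addrA.
Qed.
Next Obligation.
move=> f /=; have [r n s] := @parrow_compE (parrow_id (prange f)) f erefl.
by apply: parrow_eq; rewrite ?r ?n ?s ?add0r.
Qed.
Next Obligation.
move=> f /=; have [r n s] := @parrow_compE f (parrow_id (psource f)) erefl.
by apply: parrow_eq; rewrite ?r ?n ?s ?addr0.
Qed.

Program Definition path_groupoid : groupoid (ipath L) parrow :=
  @Groupoid _ _ path_category parrow_inv _ _ _ _.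
Next Obligation. by []. Qed.
Next Obligation. by []. Qed.
Next Obligation.
move=> g /=; have [r n s] := @parrow_compE g (parrow_inv g) erefl.
by apply: parrow_eq; rewrite ?r ?n ?s ?subrr.
Qed.
Next Obligation.
move=> g /=; have [r n s] := @parrow_compE (parrow_inv g) g erefl.
by apply: parrow_eq; rewrite ?r ?n ?s ?addNr.
Qed.

(* Z(f, h), meaningful when csource L f = csource L h *)
Definition cylinder (f h : kmor L) : set parrow :=
  [set g | exists z : ipath L, vertex z 0 = csource L f /\
    [/\ is_concat f z (prange g),
        pcocycle g = NtoZ (kdeg f) - NtoZ (kdeg h) &
        is_concat h z (psource g)]].

Definition cylinders : set (set parrow) :=
  [set Z | exists f h, csource L f = csource L h /\ Z = cylinder f h].

Lemma subNk0 (n : Nk k) : subNk n 0 = n.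
Proof. by apply/ffunP => i; rewrite !ffunE subn0. Qed.

Lemma seg0_deg (x : ipath L) (p : Nk k) : kdeg (seg x (leNk0 p)) = p.
Proof. by rewrite seg_deg subNk0. Qed.

Lemma seg0_source (x : ipath L) (p : Nk k) :
  csource L (seg x (leNk0 p)) = vertex (shift p x) 0.
Proof. by rewrite /seg fmor_source /vertex /= add0r. Qed.

Lemma cylinder_seg (g : parrow) (a b : Nk k) :
  shift a (prange g) = shift b (psource g) ->
  pcocycle g = NtoZ a - NtoZ b ->
  cylinder (seg (prange g) (leNk0 a)) (seg (psource g) (leNk0 b)) g.
Proof.
move=> ab n.
exists (shift a (prange g)); rewrite seg0_source; split=> //; split.
- by split; [rewrite seg0_deg|apply: seg_congr; rewrite ?seg0_deg].
- by rewrite !seg0_deg.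
- by split; [rewrite seg0_deg|apply: seg_congr; rewrite ?seg0_deg].
Qed.

Lemma cylinders_cover : \bigcup_(Z in cylinders) id Z = setT.
Proof.
rewrite -subTset => g _.
have [a [b [ab n]]] := parrowP g.
exists (cylinder (seg (prange g) (leNk0 a)) (seg (psource g) (leNk0 b))).
  by do 2 eexists; split; last reflexivity; rewrite !seg0_source ab.
exact: cylinder_seg.
Qed.

Lemma cylinder_sub (f h : kmor L) (g : parrow) (e : Nk k) : cylinder f h g ->
  cylinder (seg (prange g) (leNk0 (e + kdeg f)))
           (seg (psource g) (leNk0 (e + kdeg h))) `<=` cylinder f h.
Proof.
move=> [z [z0 [[xz xf] n [yz yh]]]] g'.
set a := kdeg f in xz xf n *; set b := kdeg h in yz yh n *.
move=> [z' [z'0 [[]]]]; rewrite /is_concat !seg0_deg => xz' xf' n' [yz' yh'].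
set x := prange g in xz xf xf' z'0; set y := psource g in yz yh yh'.
set x' := prange g' in xz' xf'; set y' := psource g' in yz' yh'.
have {}xf' : seg x' (leNk0 (e + a)) = seg x (leNk0 (e + a)).
  by rewrite -xf'; apply: seg_congr; rewrite ?seg0_deg.
have {}yh' : seg y' (leNk0 (e + b)) = seg y (leNk0 (e + b)).
  by rewrite -yh'; apply: seg_congr; rewrite ?seg0_deg.
have [xa xe] := seg_split (leNk0 a) (leNk_addl e a)
  (leNk0 a) (leNk_addl e a) erefl erefl xf'.
have [yb ye] := seg_split (leNk0 b) (leNk_addl e b)
  (leNk0 b) (leNk_addl e b) erefl erefl yh'.
have zz : shift a x' = shift b y'.
  apply: (@concat_inj e); first by rewrite !shiftD xz' yz'.
  rewrite !seg_shift.
  rewrite (seg_congr x' _ (leNk_addl e a)) ?add0r// xe.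
  rewrite (seg_congr y' _ (leNk_addl e b)) ?add0r// ye.
  have := congr1 (fun w => seg w (leNk0 e)) (etrans xz (esym yz)).
  rewrite !seg_shift => E.
  rewrite (seg_congr x _ (leNk_add2r a (leNk0 e))) ?add0r// E.
  by apply: seg_congr; rewrite ?add0r.
exists (shift a x'); split.
  by rewrite -seg0_source xa -xf.
split.
- by split => //; rewrite -/a xa.
- by rewrite n' !NtoZD opprD addrACA subrr add0r.
- by split; rewrite -/b; [rewrite zz|rewrite yb].
Qed.

Lemma cylinders_join (Y Z : set parrow) (g : parrow) :
  cylinders Y -> cylinders Z -> Y g -> Z g ->
  exists W, [/\ cylinders W, W g & W `<=` Y `&` Z].
Proof.
move=> [f [h [fh ->]]] [f' [h' [fh' ->]]] Yg Zg.
have [z [_ [[xz xf] n [yz yh]]]] := Yg.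
have [z' [_ [[xz' xf'] n' [yz' yh']]]] := Zg.
pose e := subNk (kdeg f') (kdeg f); pose e' := subNk (kdeg f) (kdeg f').
have Ef : e + kdeg f = e' + kdeg f'.
  by apply/ffunP => i; rewrite !addNkE !ffunE [LHS]addnC [RHS]addnC -!maxnE maxnC.
have Eh : e + kdeg h = e' + kdeg h'.
  apply/ffunP => i; rewrite !addNkE.
  have /ffunP/(_ i) := Ef; rewrite !addNkE => Efi.
  have /ffunP/(_ i) := etrans (esym n) n'; rewrite !ffunE => ni.
  by move: Efi ni; lia.
exists (cylinder (seg (prange g) (leNk0 (e + kdeg f)))
                 (seg (psource g) (leNk0 (e + kdeg h)))).
have sh : shift (e + kdeg f) (prange g) = shift (e + kdeg h) (psource g).
  by rewrite -!shiftD xz yz.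
split.
- by do 2 eexists; split; last reflexivity; rewrite !seg0_source sh.
- by apply: cylinder_seg => //; rewrite n !NtoZD opprD addrACA subrr add0r.
- move=> g' Wg'; split; first exact: cylinder_sub Yg _ Wg'.
  by move: Wg'; rewrite Ef Eh; exact: cylinder_sub Zg _.
Qed.

HB.instance Definition _ :=
  isBaseTopological.Build parrow cylinders_cover cylinders_join.

End PathGroupoid.

(* Main.v *)
Require Import Defs.
From mathcomp Require Import all_boot all_order all_algebra.
From mathcomp Require Import all_classical topology.
Local Open Scope classical_set_scope.

Set Implicit Arguments.
Unset Strict Implicit.
Unset Printing Implicit Defensive.

Import GRing.Theory.
Local Open Scope ring_scope.

(** The unit [x] has trivial isotropy exactly when no two distinct shifts of
    [x] coincide, because an arrow (x, n, x) with n = l - m records an equality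
    shift l x = shift m x. Such an equality with l <> m says that l - m is a
    period of shift m x, and a period p of shift n x gives the equality of the
    shifts by n + p^+ and n + p^-; so trivial isotropy is aperiodicity
    ([trivial_isotropyE]).

    The unit space has the sets Z(f) of infinite paths starting with f as basic
    open sets: a unit lies in Z(f, h) only if f = h. If the aperiodic paths are
    dense, each nonempty Z(v) contains one. Conversely, if w is aperiodic and
    starts at the source of f, then f w is a point of Z(f), and it is aperiodic
    because an equality of shifts of f w passes to its tail w.

    Both directions need infinite paths to exist: in Z(v) for the first one, and
    f w for the second one. They are limits of directed families of finite paths
    ([ipath_of_directed]): the initial segments of the members of such a family
    are unique in each degree, by the factorisation property, and the segment
    from m to n of the limit is what must be appended to the initial segment of
    degree m to get the one of degree n. *)

(** * Degrees *)

Lemma addNkI k (m n p : Nk k) : m + n = m + p -> n = p.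
Proof.
move=> /ffunP E; apply/ffunP => i; move: (E i).
by rewrite !addNkE => /addnI.
Qed.

Lemma NtoZ_inj k : injective (@NtoZ k).
Proof.
by move=> m n /ffunP E; apply/ffunP => i; move: (E i); rewrite !ffunE => -[].
Qed.

Lemma subNkDr k (m n : Nk k) : subNk (m + n) m = n.
Proof. by apply/ffunP => i; rewrite !ffunE addKn. Qed.

(** Multiples of (1, ..., 1) are cofinal; the sum of the entries of [n] is a
    crude bound for the largest one. *)
Lemma leNk_mulrn k (n : Nk k) :
  leNk n ([ffun=> 1%N] *+ (\sum_i n i)%N).
Proof.
apply/leNkP => i; rewrite ffunMnE ffunE.
have -> : (1%N *+ (\sum_i n i)%N)%R = (\sum_i n i)%N.
  by rewrite -mulr_natr mul1r natn.
by rewrite (bigD1 i)//= leq_addr.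
Qed.

Section Paths.
Context (k : nat) (L : kgraph k).
Implicit Types (f g h : kmor L) (x y z : ipath L) (m n : Nk k).

(** * Initial segments of finite paths *)

Lemma ccomp_cancel f g h : csource L f = crange L g ->
  csource L f = crange L h -> ccomp L f g = ccomp L f h -> g = h.
Proof.
move=> fg fh E; have := congr1 kdeg E; rewrite !kdeg_comp// => /addNkI d.
by have [] := kfact_inj fg fh E erefl d.
Qed.

(** Degree-0 paths are vertices: the two factorisations of [f] as
    (range of f) f and f (source of f) have factors of the same degrees. *)
Lemma deg0_cident f : kdeg f = 0 -> f = cident L (crange L f).
Proof.
move=> f0.
have [] // := @kfact_inj _ _ f (cident L (csource L f))
  (cident L (crange L f)) f; rewrite ?crange_id ?csource_id ?kdeg_id//.
by rewrite ccomp_idl ccomp_idr.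
Qed.

Definition initial f h : Prop :=
  exists g, csource L f = crange L g /\ h = ccomp L f g.

Lemma initial_refl f : initial f f.
Proof.
by exists (cident L (csource L f)); rewrite crange_id ccomp_idr.
Qed.

Lemma initial_trans f g h : initial f g -> initial g h -> initial f h.
Proof.
move=> [a [fa ->]] [b [ab ->]]; rewrite csource_comp// in ab.
by exists (ccomp L a b); rewrite crange_comp// ccompA.
Qed.

Lemma initial_uniq f g h : initial f h -> initial g h -> kdeg f = kdeg g ->
  f = g.
Proof.
move=> [a [fa ->]] [b [gb E]] d.
have := congr1 kdeg E; rewrite !kdeg_comp// -d => /addNkI ab.
by have [] := kfact_inj fa gb E d ab.
Qed.

Lemma initial_exists h n : leNk n (kdeg h) ->
  exists2 f, initial f h & kdeg f = n.
Proof.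
move=> nh; have [[f g] [[/= fg -> df _] _]] := kfact (esym (subNkK nh)).
by exists f => //; exists g.
Qed.

Lemma initial_ccomp f g h : csource L f = crange L g -> initial g h ->
  initial (ccomp L f g) (ccomp L f h).
Proof.
by move=> fg [a [ga ->]]; exists a; rewrite csource_comp// ccompA.
Qed.

Lemma initial_seg x m n (mn : leNk m n) :
  initial (seg x (leNk0 m)) (seg x (leNk0 n)).
Proof.
by exists (seg x mn); split; [exact: seg_composable|exact: seg_comp].
Qed.

(** * Infinite paths from finite ones *)

(** The path is [m <= n |-> t] with [G n = G m t]; functoriality is left
    cancellation. *)
Lemma ipath_of_initial (G : Nk k -> kmor L) :
  (forall n, kdeg (G n) = n) ->
  (forall m n, leNk m n -> initial (G m) (G n)) ->
  exists x, forall n, seg x (leNk0 n) = G n.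
Proof.
move=> dG iG.
have /choice[t tP] : forall a : kmor (Omega k), exists g,
    csource L (G (sval a).1) = crange L g /\
    G (sval a).2 = ccomp L (G (sval a).1) g.
  by move=> a; exact: iG (svalP a).
have ts a : csource L (t a) = csource L (G (sval a).2).
  by have [sr ->] := tP a; rewrite csource_comp.
have t_id v : t (cident (Omega k) v) = cident L (csource L (G v)).
  have [sr E] := tP (cident (Omega k) v).
  by apply: ccomp_cancel sr _ _; rewrite ?crange_id// -E ccomp_idr.
have t_comp a b : csource (Omega k) a = crange (Omega k) b ->
    t (ccomp (Omega k) a b) = ccomp L (t a) (t b).
  move=> ab; have [] := tP (ccomp (Omega k) a b).
  rewrite [sval _]omega_compE//= => sr E.
  have [sa Ea] := tP a; have [sb Eb] := tP b.
  have tab : csource L (t a) = crange L (t b).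
    by rewrite ts -sb; congr (csource L (G _)).
  apply: ccomp_cancel sr _ _; first by rewrite crange_comp.
  by rewrite -E -ccompA// -Ea Eb; congr (ccomp L (G _) _); exact/esym.
have t_deg a : kdeg (t a) = kdeg a.
  have [sr E] := tP a; have := congr1 kdeg E.
  by rewrite kdeg_comp// !dG /= => ->; rewrite subNkDr.
pose x : ipath L := @KMorphism k (Omega k) L (fun n => csource L (G n)) t
  (fun a => esym (tP a).1) ts t_id t_comp t_deg.
exists x => n; have [/= sr E] := tP (omor (leNk0 n)).
rewrite (deg0_cident (dG 0)) csource_id in sr.
by rewrite /seg /= E (deg0_cident (dG 0)) sr ccomp_idl.
Qed.

(** In each degree all the members of [P] that are long enough have the same
    initial segment, since any two of them extend to a common one. *)
Lemma ipath_of_directed (P : set (kmor L)) :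
  (forall n, exists2 h, P h & leNk n (kdeg h)) ->
  (forall f g, P f -> P g -> exists h, [/\ P h, initial f h & initial g h]) ->
  exists x, forall f, P f -> seg x (leNk0 (kdeg f)) = f.
Proof.
move=> cofP dirP.
have uniqP f g a b : P a -> P b -> initial f a -> initial g b ->
    kdeg f = kdeg g -> f = g.
  move=> Pa Pb fa gb; have [h [_ ah bh]] := dirP _ _ Pa Pb.
  exact: initial_uniq (initial_trans fa ah) (initial_trans gb bh).
have /choice[G GP] : forall n, exists g,
    kdeg g = n /\ exists2 h, P h & initial g h.
  move=> n; have [h Ph nh] := cofP n.
  by have [g gh dg] := initial_exists nh; exists g; split=> //; exists h.
have dG n : kdeg (G n) = n by have [] := GP n.
have [|x xG] := ipath_of_initial dG.
  move=> m n mn; have [_ [a Pa ma]] := GP m; have [_ [b Pb nb]] := GP n.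
  have [|g gn dg] := @initial_exists (G n) m; first by rewrite dG.
  rewrite (uniqP _ g _ _ Pa Pb ma)// ?dG//.
  exact: initial_trans gn nb.
exists x => f Pf; rewrite xG; have [_ [a Pa fa]] := GP (kdeg f).
exact: uniqP Pa Pf fa (initial_refl f) (dG _).
Qed.

(** Appending paths of degree (1, ..., 1) over and over, starting at [v], gives
    a chain of finite paths of cofinal degrees. *)
Lemma ipath_from : (forall (v : kobj L) n, kpaths n v !=set0) ->
  forall v : kobj L, exists x, vertex x 0 = v.
Proof.
move=> ne v.
pose one : Nk k := [ffun=> 1%N].
have /choice[e eP] := ne ^~ one.
pose F := fix F j := if j is j'.+1
  then ccomp L (F j') (e (csource L (F j'))) else cident L v.
have FS j : csource L (F j) = crange L (e (csource L (F j))).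
  by have [_ ->] := eP (csource L (F j)).
have dF j : kdeg (F j) = one *+ j.
  elim: j => [|j IH] /=; first by rewrite kdeg_id mulr0n.
  by rewrite kdeg_comp// IH mulrSr; have [->] := eP (csource L (F j)).
have iF i j : initial (F i) (F (i + j)%N).
  elim: j => [|j IH]; first by rewrite addn0; exact: initial_refl.
  apply: initial_trans IH _; rewrite addnS /=.
  by exists (e (csource L (F (i + j)%N))).
have [||x xF] := @ipath_of_directed (range F).
- move=> n; exists (F (\sum_i n i)%N); first by exists (\sum_i n i)%N.
  by rewrite dF; exact: leNk_mulrn.
- move=> _ _ [i _ <-] [j _ <-]; exists (F (i + j)%N).
  by split; [exists (i + j)%N|exact: iF|rewrite addnC; exact: iF].
exists x; have := xF (cident L v); rewrite /seg /vertex => xv.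
have /(congr1 (crange L)) := xv (ex_intro2 _ _ 0%N I erefl).
by rewrite fmor_range crange_id.
Qed.

(** The paths f x(0, n) form a directed family, and their limit is f x. *)
Lemma concat_exists f x : vertex x 0 = csource L f ->
  exists y, is_concat f x y.
Proof.
move=> xf.
pose F n := ccomp L f (seg x (leNk0 n)).
have fx n : csource L f = crange L (seg x (leNk0 n)).
  by rewrite -xf /seg fmor_range.
have dF n : kdeg (F n) = kdeg f + n by rewrite kdeg_comp// seg0_deg.
have iF m n : leNk m n -> initial (F m) (F n).
  by move=> mn; apply: initial_ccomp => //; exact: initial_seg.
have [||y yF] := @ipath_of_directed (range F).
- by move=> n; exists (F n); [exists n|rewrite dF; exact: leNk_addl].
- move=> _ _ [m _ <-] [n _ <-]; exists (F (m + n)).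
  by split; [exists (m + n)|apply: iF; exact: leNk_addr|
             apply: iF; exact: leNk_addl].
have yF' n : ccomp L (seg y (leNk0 (kdeg f))) (seg y (leNk_addr (kdeg f) n))
    = ccomp L f (seg x (leNk0 n)).
  rewrite -(seg_comp y _ _ (leNk0 (kdeg f + n))) -[RHS]yF; last by exists n.
  by apply: seg_congr; rewrite ?dF.
have yn n : seg y (leNk0 (kdeg f)) = f /\
    seg y (leNk_addr (kdeg f) n) = seg x (leNk0 n).
  apply: kfact_inj (yF' n) _ _ => //; rewrite ?seg0_deg//.
  - exact: seg_composable.
  - by rewrite seg_deg subNkDr.
exists y; split; last by have [] := yn 0.
apply: ipath_eq => m n mn.
have E : seg (shift (kdeg f) y) (leNk0 n) = seg x (leNk0 n).
  by rewrite seg_shift -(yn n).2; apply: seg_congr; rewrite ?add0r// addrC.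
by have [] := seg_split (leNk0 m) mn (leNk0 m) mn erefl erefl E.
Qed.

(** * Aperiodicity and isotropy *)

Lemma aperiodicE x :
  aperiodic x <-> forall l m, shift l x = shift m x -> l = m.
Proof.
split=> [apx l m lm|inj [n [p p0 per]]].
- apply: contrapT => ne; apply: apx; exists m.
  exists (NtoZ l - NtoZ m).
    by apply/eqP => /eqP; rewrite subr_eq0 => /eqP /NtoZ_inj /ne.
  have shE a a' : NtoZ a' = NtoZ a + (NtoZ l - NtoZ m) -> a' + m = a + l.
    move=> E; apply: NtoZ_inj; rewrite !NtoZD E.
    by rewrite -addrA subrK.
  move=> a b a' b' ab ab' /shE Ea /shE Eb.
  rewrite seg_shift (seg_congr x _ (leNk_add2r l ab))//.
  by rewrite -[LHS]seg_shift lm.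
-
  (* p = pp - pm, its positive and negative parts *)
  pose pp : Nk k := [ffun i => if (0 <= p i)%R then `|p i|%N else 0%N].
  pose pm : Nk k := [ffun i => if (0 <= p i)%R then 0%N else `|p i|%N].
  have pE : p = NtoZ pp - NtoZ pm.
    by apply/ffunP => i; rewrite !ffunE; case: (p i) => j /=; rewrite ?subr0 ?sub0r.
  suff /inj E : shift (pp + n) x = shift (pm + n) x.
    have {}E : pp = pm by apply: (@addNkI _ n); rewrite ![n + _]addrC.
    by move: p0; rewrite pE E subrr eqxx.
  rewrite -!shiftD; apply: ipath_eq => a b ab.
  rewrite !(seg_shift pp, seg_shift pm).
  by apply: per; rewrite !NtoZD pE -addrA; congr (_ + _); rewrite addrC subrK.
Qed.

Lemma trivial_isotropyE x :
  isotropy (path_groupoid L) x = [set cident (path_groupoid L) x]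
  <-> aperiodic x.
Proof.
rewrite aperiodicE; split=> [triv l m lm|inj].
- pose g := @PArrow k L x (NtoZ l - NtoZ m) x
    (ex_intro _ l (ex_intro _ m (conj lm erefl))).
  have : isotropy (path_groupoid L) x g by [].
  rewrite triv => /(congr1 (@pcocycle k L)) /= /eqP.
  by rewrite subr_eq0 => /eqP /NtoZ_inj.
- apply/seteqP; split=> [g /= [gr gs]|_ ->]; last by [].
  rewrite /= in gr gs.
  have [l [m [lm n]]] := parrowP g; rewrite gr gs in lm.
  by apply: parrow_eq; rewrite ?gr ?gs//= n (inj _ _ lm) subrr.
Qed.

(** An equality between shifts of f x persists after the common shift by the
    degree of f, which is an equality between shifts of x. *)
Lemma aperiodic_concat f x y : is_concat f x y -> aperiodic x -> aperiodic y.
Proof.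
move=> [yx _] /aperiodicE inj; apply/aperiodicE => l m lm; apply: inj.
by rewrite -yx !shiftD ![_ + kdeg f]addrC -!shiftD lm.
Qed.

(** * The topology of the unit space *)

Lemma cylinder_open f h : csource L f = csource L h -> open (cylinder f h).
Proof.
move=> fh; exists [set cylinder f h]; last by rewrite bigcup_set1.
by move=> _ ->; exists f, h.
Qed.

Lemma open_cylinderP (A : set (parrow L)) (a : parrow L) : open A -> A a ->
  exists f h, [/\ csource L f = csource L h, cylinder f h a &
    cylinder f h `<=` A].
Proof.
move=> [D DZ <-] [Z DZ' Za]; have [f [h [fh ZE]]] := DZ _ DZ'.
by exists f, h; split=> //; rewrite -?ZE// => b Zb; exists Z.
Qed.

Lemma cylinder_unit f x :
  cylinder f f (parrow_id x) <-> seg x (leNk0 (kdeg f)) = f.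
Proof.
split=> [[z [_ [[]]]]//|xf]; exists (shift (kdeg f) x).
by rewrite -seg0_source xf; split=> //=; rewrite subrr.
Qed.

(** The cocycle of a unit is 0, so [f] and [h] have the same degree, and then
    they are the same initial segment of [x]. *)
Lemma cylinder_unit_eq f h x : cylinder f h (parrow_id x) -> f = h.
Proof.
move=> [z [_ [[_ xf] /esym/eqP]]]; rewrite /= subr_eq0 => /eqP /NtoZ_inj d [_ xh].
by rewrite -xf -xh; exact: seg_congr.
Qed.

End Paths.

Theorem proposition4p5 (k : nat) (k_ge1 : (1 <= k)%N) (L : kgraph k)
    (L_rowfinite_nosources : forall (v : kobj L) (n : Nk k),
       kpaths n v !=set0 /\ finite_set (kpaths n v)) :
  essentially_free (path_groupoid L) <-> aperiodicity_condition L.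
Proof.
split=> [dns v|aper O [x Ox] [A oA AO]].
- pose U : set (initial_topology (cident (path_groupoid L))) :=
    cident (path_groupoid L) @^-1` cylinder (cident L v) (cident L v).
  have UE x : U x <-> vertex x 0 = v.
    rewrite /U /preimage /= cylinder_unit.
    split=> [/(congr1 (crange L))|xv]; first by rewrite crange_id /seg fmor_range.
    rewrite [LHS]deg0_cident ?seg0_deg ?kdeg_id//.
    by rewrite /seg fmor_range -[fobj _ _]/(vertex x 0) xv.
  have [||x [/UE xv /trivial_isotropyE apx]] := dns U; last by exists x.
  + have [x xv] := ipath_from (fun v n => (L_rowfinite_nosources v n).1) v.
    by exists x; apply/UE.
  + by exists (cylinder (cident L v) (cident L v)) => //; exact: cylinder_open.
- have Ax : A (parrow_id x) by move: Ox; rewrite -AO.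
  have [f [h [_ fhx fhA]]] := open_cylinderP oA Ax.
  have E := cylinder_unit_eq fhx; subst h.
  have [w wf apw] := aper (csource L f).
  have [y fwy] := concat_exists wf; have [_ yf] := fwy.
  exists y; split; last exact/trivial_isotropyE/(aperiodic_concat fwy).
  by rewrite -AO; apply: fhA; apply/cylinder_unit.
Qed.
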